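(* For all $d\in\mathbb{N}$, we have $T_{\mathcal{A}}(\{1\}^{2d})=0$ in $\mathcal{A}$.
   Context: $\mathbb{N}$ is the set of positive integers, $\mathcal{P}$ the set of primes, and $\mathcal{A}:=\prod_{p\in\mathcal{P}}(\mathbb{Z}/p\mathbb{Z})\big/\bigoplus_{p\in\mathcal{P}}(\mathbb{Z}/p\mathbb{Z})$, so that equality in $\mathcal{A}$ means equality of components for all but finitely many $p$. Finite multiple $T$-values: for $\mathbf{s}=(s_1,\dots,s_d)\in\mathbb{N}^d$, $$T_{\mathcal{A}}(\mathbf{s}):=\Bigg(\sum_{\substack{p>n_1>\dots>n_d>0\\ n_j\equiv d-j+1\ (\mathrm{mod}\ 2)}}\ \prod_{j=1}^d\frac{1}{n_j^{s_j}}\ (\mathrm{mod}\ p)\Bigg)_{p\in\mathcal{P}}\in\mathcal{A}.$$ $\{1\}^{n}$ denotes the string $1,\dots,1$ with $n$ entries. *)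

(* Defs.v *)
From HB Require Import structures.
From mathcomp Require Import all_boot all_order all_algebra.
From mathcomp Require Import all_classical.

Set Implicit Arguments.
Unset Strict Implicit.
Unset Printing Implicit Defensive.
Set Warnings "-redundant-canonical-projection".

Import GRing.Theory.

Local Open Scope classical_set_scope.
Local Open Scope ring_scope.
Local Open Scope quotient_scope.

Definition primeNat := {p : nat | prime p}.

Definition prodFp := forall p : primeNat, 'F_(val p).

HB.instance Definition _ :=
  Choice.copy prodFp (forall p : primeNat, 'F_(val p)).

Section ProdFpRing.
Implicit Types x y z : prodFp.

Let zero : prodFp := fun=> 0.
Let opp x : prodFp := fun p => - x p.
Let add x y : prodFp := fun p => x p + y p.
Let one : prodFp := fun=> 1.
Let mul x y : prodFp := fun p => x p * y p.

Let addA : associative add.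
Proof. by move=> x y z; apply: functional_extensionality_dep => p; exact: addrA. Qed.
Let addC : commutative add.
Proof. by move=> x y; apply: functional_extensionality_dep => p; exact: addrC. Qed.
Let add0 : left_id zero add.
Proof. by move=> x; apply: functional_extensionality_dep => p; exact: add0r. Qed.
Let addN : left_inverse zero opp add.
Proof. by move=> x; apply: functional_extensionality_dep => p; exact: addNr. Qed.
Let mulA : associative mul.
Proof. by move=> x y z; apply: functional_extensionality_dep => p; exact: mulrA. Qed.
Let mulC : commutative mul.
Proof. by move=> x y; apply: functional_extensionality_dep => p; exact: mulrC. Qed.
Let mul1 : left_id one mul.
Proof. by move=> x; apply: functional_extensionality_dep => p; exact: mul1r. Qed.
Let mulD : left_distributive mul add.
Proof. by move=> x y z; apply: functional_extensionality_dep => p; exact: mulrDl. Qed.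
Let one_neq0 : one != zero.
Proof.
apply/eqP => /(congr1 (fun x : prodFp => x (exist _ 2 isT))).
by move/eqP; rewrite oner_eq0.
Qed.

HB.instance Definition _ := GRing.isZmodule.Build prodFp addA addC add0 addN.
HB.instance Definition _ :=
  GRing.Zmodule_isComNzRing.Build prodFp mulA mulC mul1 mulD one_neq0.

End ProdFpRing.

Definition sumFp : {pred prodFp} :=
  fun x => `[< finite_set [set p | x p != 0] >].

Lemma infinite_primeNat : infinite_set [set: primeNat].
Proof.
move=> /finite_seqP[s sE].
have [q lt_q pr_q] := prime_above (\max_(p <- s) val p)%N.
have qs : (exist _ q pr_q : primeNat) \in s.
  have : [set: primeNat] (exist _ q pr_q : primeNat) by [].
  by rewrite sE.
move: lt_q; rewrite ltnNge => /negP[].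
exact: (@leq_bigmax_seq _ s xpredT (fun p : primeNat => val p) _ qs isT).
Qed.

Lemma sumFp_idealr_closed : idealr_closed sumFp.
Proof.
split.
- apply/asboolP; rewrite (_ : [set _ | _] = set0)//.
  by apply/seteqP; split => // p /=; rewrite eqxx.
- apply/negP => /asboolP; rewrite (_ : [set _ | _] = setT).
    exact: infinite_primeNat.
  by apply/seteqP; split => // p _ /=; exact: oner_neq0.
- move=> a x y /asboolP xf /asboolP yf; apply/asboolP.
  apply: (@sub_finite_set _ _
    ([set p | x p != 0] `|` [set p | y p != 0])); last by rewrite finite_setU.
  move=> p /= axy; apply/orP; apply: contraNT axy.
  rewrite negb_or !negbK => /andP[/eqP xp0 /eqP yp0].
  have -> : (a * x + y) p = a p * x p + y p by [].
  by rewrite xp0 yp0 mulr0 addr0.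
Qed.

HB.instance Definition _ := isIdealr.Build prodFp sumFp sumFp_idealr_closed.

Notation calA := {ideal_quot sumFp}.

Lemma eq_calA (x y : prodFp) :
  \pi_calA x = \pi_calA y <-> finite_set [set p | x p != y p].
Proof.
have -> : [set p | x p != y p] = [set p | (x - y) p != 0].
  by apply/seteqP; split=> p /=; rewrite -(subr_eq0 (x p)).
split=> [/eqP|fin]; first by rewrite -Quotient.idealrBE => /asboolP.
by apply/eqP; rewrite -Quotient.idealrBE; apply/asboolP.
Qed.

(* Indices are shifted to start at 0: [n j] and [tnth s j] are n_(j+1) and
   s_(j+1), so the parity condition n_j = d - j + 1 (mod 2) becomes
   [n j = d - j %[mod 2]].  Since 0 < n j < p, the images [(n j)%:R] are units.
   Only positive exponents [s] are meant. *)
Definition T_index (d p : nat) (n : {ffun 'I_d -> 'I_p}) : bool :=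
  [&& [forall i : 'I_d, forall j : 'I_d, (i < j)%N ==> (n j < n i)%N],
      [forall j : 'I_d, (0 < n j)%N] &
      [forall j : 'I_d, (n j == d - j %[mod 2])%N]].

Definition T_mod (d : nat) (s : d.-tuple nat) : prodFp := fun p =>
  \sum_(n : {ffun 'I_d -> 'I_(val p)} | T_index n)
     \prod_(j < d) ((n j)%:R ^+ tnth s j)^-1.

Definition T_A (d : nat) (s : d.-tuple nat) : calA := \pi_calA (T_mod s).

(* Main.v *)
Require Import Defs.
From mathcomp Require Import all_boot all_order all_algebra.
From mathcomp Require Import finfield all_classical ring zify.

(* Fix an odd prime p and collect the sums over chains p > n_1 > ... > n_l > 0 of
   even length l into U(x) = \sum_(l < p, l even) T_p({1}^l) x^l over F_p.  For
   x = 2m with 0 < m < p put Q = (1+X)^(m-1) (1-X)^(p-m-1), so that (1-X^2) Q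
   agrees modulo X^p with ((1+X)/(1-X))^m, and ((1-X^2) Q)' = x Q in
   characteristic p.  Reading off coefficients, the n-th coefficient of Q is the
   generating series at x of the chains below n+1 with length of the parity of n.
   Since Q has degree p-2, its coefficient of index p-1, which is U(x), is zero.
   Hence U has degree at most p-1 and vanishes on the nonzero elements of F_p, so it
   is a multiple of X^(p-1) - 1, and its coefficient of index 2d is zero as soon
   as 0 < 2d < p-1. *)

Set Implicit Arguments.
Unset Strict Implicit.
Unset Printing Implicit Defensive.

Import GRing.Theory.
Local Open Scope ring_scope.

(** * Chain sums and their generating series *)

(* Sum of 1 / (n_1 ... n_d) over b > n_1 > ... > n_d > 0 with n_j = d - j + 1
   modulo 2. *)
Fixpoint chain_sum (F : fieldType) (d b : nat) : F :=
  if d is d'.+1 then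
    \sum_(k < b | (0 < k)%N && (odd k == odd d)) k%:R^-1 * chain_sum F d' k
  else 1.

Arguments chain_sum : simpl never.

Lemma chain_sum_rec (F : fieldType) (d b : nat) :
  chain_sum F d.+1 b =
  \sum_(k < b | (0 < k)%N && (odd k == odd d.+1)) k%:R^-1 * chain_sum F d k.
Proof. by []. Qed.

Lemma chain_sumS (F : fieldType) (d b : nat) :
  chain_sum F d.+1 b.+1 = chain_sum F d.+1 b +
    (if (0 < b)%N && (odd b == odd d.+1) then b%:R^-1 * chain_sum F d b else 0).
Proof. by rewrite chain_sum_rec big_mkcond big_ord_recr /= -big_mkcond. Qed.

Lemma chain_sumS_1 (F : fieldType) (d : nat) : chain_sum F d.+1 1 = 0.
Proof. by rewrite chain_sumS addr0 chain_sum_rec big_ord0. Qed.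

(** The largest entry n_1 has the parity of [d], so a [b] of the other parity cannot occur as
    n_1. *)
Lemma chain_sum_stable (F : fieldType) (d b : nat) : (0 < b)%N ->
  odd b != odd d -> chain_sum F d b.+1 = chain_sum F d b.
Proof.
case: d => // d b_gt0 /negPf hb.
by rewrite chain_sumS hb andbF addr0.
Qed.

Definition chain_gen (F : fieldType) (N n : nat) (a : F) : F :=
  \sum_(d < N | odd d == odd n) chain_sum F d n.+1 * a ^+ d.

Lemma chain_gen0 (F : fieldType) (N : nat) (a : F) :
  (0 < N)%N -> chain_gen N 0 a = 1.
Proof.
case: N => // N _.
rewrite /chain_gen big_mkcond big_ord_recl /= mulr1 big1 ?addr0 // => i _.
by rewrite chain_sumS_1 mul0r; case: ifP.
Qed.

Lemma chain_gen1 (F : fieldType) (N : nat) (a : F) :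
  (1 < N)%N -> chain_gen N 1 a = a.
Proof.
case: N => // -[] // N _.
rewrite /chain_gen big_mkcond !big_ord_recl /= big1 => [|i _].
  by rewrite add0r addr0 chain_sumS chain_sumS_1 /= add0r invr1 !mul1r.
rewrite chain_sumS chain_sumS_1 add0r; case: ifP => // _.
by rewrite /= chain_sumS_1 mulr0 if_same mul0r.
Qed.

(** Split on whether n_1 = n+2. If so, removing it leaves a chain below n+2 that is shorter by one,
    whence the smaller truncation [N]; if not, n_1 <= n, since n+1 has the wrong parity. *)
Lemma chain_genSS (F : fieldType) (N n : nat) (a : F) :
  chain_gen N.+1 n.+2 a =
  chain_gen N.+1 n a + a / n.+2%:R * chain_gen N n.+1 a.
Proof.
rewrite /chain_gen [LHS]big_mkcond [X in _ = X + _]big_mkcond !big_ord_recl /=.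
rewrite -addrA; congr (_ + _); first by rewrite negbK.
rewrite [X in _ = _ + _ * X]big_mkcond mulr_sumr -big_split /=.
apply: eq_bigr => i _; rewrite /bump leq0n !add1n /= !add0n !negbK.
rewrite [in LHS]chain_sumS /= ?negbK.
case: eqVneq => [h|h]; last first.
  have -> : (odd i == ~~ odd n) = false by case: (odd i) (odd n) h => -[].
  by rewrite mulr0 addr0.
have -> : (odd i == ~~ odd n) by rewrite -h negbK.
rewrite -/(chain_sum F i.+1 n.+2) chain_sum_stable //=; last first.
  by rewrite h; case: (odd n).
by rewrite mulrDl exprS; congr (_ + _); ring.
Qed.

Lemma natFp_neq0 (p n : nat) : prime p -> (0 < n < p)%N -> n%:R != 0 :> 'F_p.
Proof.
move=> p_pr /andP[n0 np].
by rewrite -(dvdn_pcharf (pchar_Fp p_pr)) gtnNdvd.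
Qed.

Lemma coef_mul_1subX2 (R : nzRingType) (q : {poly R}) (n : nat) :
  ((1 - 'X ^+ 2) * q)`_n = q`_n - (if (n < 2)%N then 0 else q`_(n - 2)).
Proof. by rewrite mulrBl mul1r coefB coefXnM. Qed.

(** * The polynomial Q, with [m], [n] for the exponents m-1, p-m-1 of the overview *)

Section Witness.
Variables (F : fieldType) (p m n : nat).
Hypotheses (pF : p \in [pchar F]) (mnp : (m.+1 + n.+1 = p)%N).

Let Q : {poly F} := (1 + 'X) ^+ m * (1 - 'X) ^+ n.

Lemma deriv_witness : ((1 - 'X ^+ 2) * Q)^`() = (m.+1.*2)%:R *: Q.
Proof.
(* This is where characteristic p enters: the two exponents of (1-X^2) Q add up to p, hence are
   opposite in [F]. *)
have nE : n.+1%:R = - m.+1%:R :> {poly F}.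
  apply/eqP; rewrite -addr_eq0 addrC -natrD mnp -polyC_natr.
  by rewrite (pcharf0 pF).
have -> : (1 - 'X ^+ 2) * Q = (1 + 'X) ^+ m.+1 * (1 - 'X) ^+ n.+1.
  by rewrite /Q !exprS; ring.
rewrite derivM !deriv_exp derivB derivD derivX derivC add0r sub0r /=.
rewrite -[in RHS]mul_polyC polyC_natr -muln2 natrM.
rewrite -[_ *+ m.+1]mulr_natr -[_ *+ n.+1]mulr_natr nE /Q !exprS.
ring.
Qed.

Lemma witness0 : Q`_0 = 1.
Proof. by rewrite -horner_coef0 /Q !hornerE /= ?addr0 ?subr0 !expr1n mulr1. Qed.

Lemma witness1 : Q`_1 = (m.+1.*2)%:R.
Proof.
have := congr1 (fun P : {poly F} => P`_0) deriv_witness.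
by rewrite coef_deriv coefZ coef_mul_1subX2 /= witness0 subr0 mulr1n mulr1.
Qed.

(** This is the recurrence of [chain_genSS] at a = 2(m+1), cleared of its denominator. *)
Lemma witnessSS (k : nat) :
  k.+2%:R * (Q`_k.+2 - Q`_k) = (m.+1.*2)%:R * Q`_k.+1.
Proof.
have := congr1 (fun P : {poly F} => P`_k.+1) deriv_witness.
rewrite coef_deriv coefZ coef_mul_1subX2 /= => <-.
by rewrite subn2 mulr_natl.
Qed.

Lemma witness_last : Q`_p.-1 = 0.
Proof.
apply: nth_default; apply: leq_trans (size_polyMleq _ _) _.
have s1 : (size ((1 + 'X) ^+ m : {poly F}) <= m.+1)%N.
  apply: leq_trans (size_poly_exp_leq _ _) _.
  by rewrite addrC -[1]/(1%:P) size_XaddC mul1n.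
have s2 : (size ((1 - 'X) ^+ n : {poly F}) <= n.+1)%N.
  apply: leq_trans (size_poly_exp_leq _ _) _.
  by rewrite -opprB size_polyN -[1]/(1%:P) size_XsubC mul1n.
by rewrite -mnp -!subn1 leq_sub2r // leq_add.
Qed.

End Witness.

(** * Vanishing at nonzero points, and of the coefficients *)

Lemma chain_gen_root (p : nat) (a : 'F_p) : prime p -> odd p -> a != 0 ->
  chain_gen p p.-1 a = 0.
Proof.
move=> p_pr p_odd a_neq0.
have p_gt2 : (2 < p)%N by rewrite odd_prime_gt2.
have two_neq0 : 2%:R != 0 :> 'F_p by rewrite natFp_neq0.
have pF := pchar_Fp p_pr.
pose h : 'F_p := a / 2%:R.
have h_neq0 : h != 0 by rewrite mulf_neq0 ?invr_eq0.
have h_lt : (h < p)%N by rewrite -{2}(Fp_cast p_pr) ltn_ord.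
have h_gt0 : (0 < h)%N.
  by rewrite lt0n; apply: contra h_neq0 => /eqP h0; apply/eqP/val_inj.
have aE : ((h : nat).-1.+1.*2)%:R = a.
  by rewrite prednK // -muln2 natrM natr_Zp divfK.
have mnp : ((h : nat).-1.+1 + (p - h).-1.+1 = p)%N by lia.
set Q := ((1 + 'X) ^+ (h : nat).-1 * (1 - 'X) ^+ (p - h).-1 : {poly 'F_p}).
(* [N] must vary because the recurrence lowers it; n < N keeps every chain below n+1, and n < p
   keeps the denominators invertible. *)
suff genE n N : (n < p)%N -> (n < N)%N -> chain_gen N n a = Q`_n.
  by rewrite genE ?witness_last // prednK ?prime_gt0.
elim/ltn_ind: n N => -[|[|n]] IH N np nN.
- by rewrite chain_gen0 // witness0.
- by rewrite chain_gen1 // (witness1 pF mnp) aE.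
case: N nN => // N nN.
have np1 := ltnW np.
rewrite chain_genSS (IH n) ?(IH n.+1) ?(ltnW np1) ?(ltnW (ltnW nN)) //.
have n_neq0 : n.+2%:R != 0 :> 'F_p by rewrite natFp_neq0.
have := witnessSS pF mnp n; rewrite aE -/Q => /(canRL (mulKf n_neq0)) E.
by rewrite -mulrA mulrCA -E addrC subrK.
Qed.

(* [U] is proportional to ['X^(#|F| - 1) - 1]; multiplying by ['X] makes the roots
   exactly the elements of [F]. *)
Lemma poly_roots_nonzero_coef0 (F : finFieldType) (U : {poly F}) (i : nat) :
  (size U <= #|F|)%N -> (forall a, a != 0 -> U.[a] = 0) ->
  (0 < i < #|F|.-1)%N -> U`_i = 0.
Proof.
move=> sU rU /andP[i_gt0 i_lt].
set q := #|F| in sU i_lt *.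
have q_gt1 : (1 < q)%N by apply: finNzRing_gt1.
(* The subtracted term cancels the coefficient of X^q, so [W] has degree below q but q roots. *)
pose W := 'X * U - U`_q.-1 *: ('X ^+ q - 'X).
have W_roots : all (root W) (enum F).
  apply/allP => a _; rewrite /root /W !hornerE /= expf_card subrr mulr0 subr0.
  by case: (eqVneq a 0) => [->|/rU ->]; rewrite ?mul0r ?mulr0.
have sW : (size W <= q)%N.
  apply/leq_sizeP => j; rewrite leq_eqVlt coefB coefXM coefZ coefB coefXn coefX.
  case/orP => [/eqP <-|qj].
    by rewrite eqxx !gtn_eqF ?(ltnW q_gt1) // subr0 mulr1 subrr.
  rewrite !gtn_eqF ?(ltn_trans q_gt1 qj) ?(ltn_trans (ltnW q_gt1) qj) //.
  rewrite subrr mulr0 subr0 nth_default ?if_same //.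
  by case: j qj => // j; exact: leq_trans sU.
have W0 : W = 0.
  apply: (roots_geq_poly_eq0 W_roots); first exact: enum_uniq.
  by rewrite -cardE.
have := congr1 (fun P : {poly F} => P`_i.+1) W0.
rewrite coefB coefXM coefZ coefB coefXn coefX coef0 /=.
have -> : (i.+1 == q) = false by lia.
have -> : (i.+1 == 1)%N = false by lia.
by rewrite subr0 mulr0 subr0.
Qed.

Lemma chain_sum_even_eq0 (p d : nat) : prime p -> (0 < d)%N ->
  ((2 * d).+1 < p)%N -> chain_sum 'F_p (2 * d) p = 0.
Proof.
move=> p_pr d_gt0 dp.
have p_odd : odd p by case: (even_prime p_pr) => // p2; lia.
(* As p-1 is even, evaluating [U] gives [chain_gen p p.-1]. *)
pose U : {poly 'F_p} := \poly_(l < p) if ~~ odd l then chain_sum 'F_p l p else 0.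
have <- : U`_(2 * d) = chain_sum 'F_p (2 * d) p.
  by rewrite coef_poly oddM /= (ltn_trans _ dp).
have cardF : #|'F_p| = p by rewrite card_Fp.
apply: poly_roots_nonzero_coef0; rewrite ?cardF; [exact: size_poly| |lia].
move=> a a_neq0; rewrite -[RHS](chain_gen_root p_pr p_odd a_neq0).
rewrite horner_poly /chain_gen [RHS]big_mkcond; apply: eq_bigr => l _.
have p_gt0 := prime_gt0 p_pr.
have -> : odd p.-1 = false by move: p_odd; rewrite -{1}(prednK p_gt0) /=; case: odd.
by rewrite prednK // eqbF_neg; case: ifP => // _; rewrite mul0r.
Qed.

(** * From sums over index functions to chain sums *)

Definition ffun_cons (T : Type) (d : nat) (k : T) (f : {ffun 'I_d -> T}) :
    {ffun 'I_d.+1 -> T} :=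
  [ffun i => if unlift ord0 i is Some j then f j else k].

Lemma ffun_cons0 (T : Type) (d : nat) (k : T) (f : {ffun 'I_d -> T}) :
  ffun_cons k f ord0 = k.
Proof. by rewrite ffunE unlift_none. Qed.

Lemma ffun_consS (T : Type) (d : nat) (k : T) (f : {ffun 'I_d -> T}) (j : 'I_d) :
  ffun_cons k f (lift ord0 j) = f j.
Proof. by rewrite ffunE liftK. Qed.

Lemma big_ffun_recl (R : nmodType) (T : finType) (d : nat)
    (P : pred {ffun 'I_d.+1 -> T}) (G : {ffun 'I_d.+1 -> T} -> R) :
  \sum_(n | P n) G n = \sum_k \sum_(f | P (ffun_cons k f)) G (ffun_cons k f).
Proof.
rewrite pair_big_dep /= (reindex (fun u => ffun_cons u.1 u.2)) //=.
exists (fun n : {ffun 'I_d.+1 -> T} => (n ord0, [ffun j => n (lift ord0 j)])).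
- move=> [k f] _ /=; congr pair; first exact: ffun_cons0.
  by apply/ffunP => j; rewrite ffunE ffun_consS.
- move=> n _; apply/ffunP => i.
  by case: (unliftP ord0 i) => [j|] ->; rewrite ?ffun_consS ?ffun_cons0 ?ffunE.
Qed.

Lemma eqn_mod2 (m n : nat) : (m == n %[mod 2])%N = (odd m == odd n).
Proof. by rewrite !modn2; case: (odd m); case: (odd n). Qed.

(** Once n_1 = k is split off, k becomes the bound for the tail. The parity conditions on the tail
    are unchanged, as (d+1) - (j+1) = d - j. *)
Lemma T_index_cons (d p b : nat) (k : 'I_p) (f : {ffun 'I_d -> 'I_p}) :
  T_index (ffun_cons k f) && [forall j, (ffun_cons k f j < b)%N] =
  [&& (0 < k)%N && (odd k == odd d.+1), (k < b)%N
    & T_index f && [forall j, (f j < k)%N]].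
Proof.
apply/andP/and3P => [[/and3P[mono pos par] bnd]|].
  split.
  - have := forallP pos ord0; have := forallP par ord0.
    by rewrite ffun_cons0 eqn_mod2 => -> ->.
  - by have := forallP bnd ord0; rewrite ffun_cons0.
  - apply/andP; split; [apply/and3P; split|].
    + apply/'forall_forallP => i j; apply/implyP => ij.
      by have := implyP ('forall_forallP mono (lift ord0 i) (lift ord0 j));
        rewrite !ffun_consS; apply.
    + by apply/forallP => j; have := forallP pos (lift ord0 j); rewrite ffun_consS.
    + apply/forallP => j; have := forallP par (lift ord0 j).
      by rewrite ffun_consS.
    + apply/forallP => j.
      by have := implyP ('forall_forallP mono ord0 (lift ord0 j));
        rewrite ffun_consS ffun_cons0; apply.
move=> [/andP[k_gt0 k_odd] kb /andP[/and3P[mono pos par] /forallP fk]].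
split; [apply/and3P; split|].
- apply/'forall_forallP => i j; apply/implyP.
  case: (unliftP ord0 j) => [j'|] -> //.
  case: (unliftP ord0 i) => [i'|] ->; rewrite !ffun_consS ?ffun_cons0 // => ij.
  exact: implyP ('forall_forallP mono i' j') ij.
- apply/forallP => j; case: (unliftP ord0 j) => [j'|] ->.
    by rewrite ffun_consS (forallP pos).
  by rewrite ffun_cons0.
- apply/forallP => j; case: (unliftP ord0 j) => [j'|] ->.
    by rewrite ffun_consS (forallP par).
  by rewrite ffun_cons0 eqn_mod2.
- apply/forallP => j; case: (unliftP ord0 j) => [j'|] ->.
    by rewrite ffun_consS (ltn_trans (fk j')).
  by rewrite ffun_cons0.
Qed.

Lemma T_index_sum (F : fieldType) (p d b : nat) : (b <= p)%N ->
  \sum_(n : {ffun 'I_d -> 'I_p} | T_index n && [forall j, (n j < b)%N])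
     \prod_(j < d) (n j)%:R^-1 = chain_sum F d b.
Proof.
elim: d b => [|d IH] b bp.
  rewrite (big_pred1 (ffun0 (card_ord 0))) => [|n]; first by rewrite big_ord0.
  have -> : n = ffun0 (card_ord 0) by apply/ffunP => -[].
  rewrite /= eqxx /T_index -!andbA.
  by apply/and4P; split; apply/forallP => -[].
rewrite big_ffun_recl chain_sum_rec (big_ord_widen_cond _
  (fun k => (0 < k)%N && (odd k == odd d.+1))
  (fun k => k%:R^-1 * chain_sum F d k) bp).
rewrite [RHS]big_mkcond; apply: eq_bigr => k _.
rewrite (eq_bigl _ _ (T_index_cons b k)).
case: ifP => [/andP[-> ->]|kF]; last first.
  by rewrite big_pred0 // => f; rewrite andbA kF.
rewrite -IH ?mulr_sumr; last exact: ltnW.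
apply: eq_bigr => f _; rewrite big_ord_recl ffun_cons0; congr (_ * _).
by apply: eq_bigr => j _; rewrite ffun_consS.
Qed.

Lemma T_mod_ones (d : nat) (p : primeNat) :
  T_mod (nseq_tuple d 1%N) p = chain_sum 'F_(val p) d (val p).
Proof.
rewrite -(T_index_sum _ _ (leqnn (val p))); apply: eq_big => [n|n _].
  by rewrite (_ : [forall j, _]) ?andbT //; apply/forallP => j.
apply: eq_bigr => j _.
by rewrite (tnth_nth 0%N) nth_nseq ltn_ord expr1.
Qed.

Local Close Scope ring_scope.

Theorem proposition3p16 (d : nat) (d_gt0 : (0 < d)%N) :
  T_A (nseq_tuple (2 * d) 1%N) = 0%R :> calA.
Proof.
rewrite -[RHS](rmorph0 (\pi_calA)%qT); apply/eq_calA.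
(* Only primes p <= 2d+1 escape [chain_sum_even_eq0]. *)
apply: (@sub_finite_set _ _ (val @^-1` `I_(2 * d).+2)%classic).
  move=> p /=; rewrite T_mod_ones ltnS leqNgt; apply: contra => dp.
  by rewrite chain_sum_even_eq0 // (valP p).
apply: finite_preimage; last exact: finite_II.
by move=> p q _ _; exact: val_inj.
Qed.
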